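(* Let $C\subset\mathbb E$ be nonempty and closed, and let $f:\mathbb E\to\mathbb R$ be $C^1$ with locally Lipschitz gradient. Let $(\Omega,\mathcal R)$ be a safe region with return maps for $C$. Starting from any $x_0\in C$, run the MCSD--PGD algorithm (described in the context) with a norm $\|\cdot\|$ on $\mathbb E$ and parameters $\bar\alpha_M,\bar\alpha_P>0$ and $c_M,c_P,\beta_M,\beta_P\in(0,1)$. At every nonterminal iteration of the algorithm, the applicable line search (the smooth-branch line search if $x_t\in\Omega$, the PGD-fallback line search if $x_t\notin\Omega$) terminates after finitely many backtracking reductions and produces $x_{t+1}\in C$. Consequently, the algorithm either returns a point in $S_B$ after finitely many iterations or generates an infinite sequence $(x_t)_{t\in\mathbb N}$, every accumulation point of which, if any, belongs to $S_B$.
   Context: $\mathbb E$ is a (finite-dimensional) Euclidean space with inner product $\langle\cdot,\cdot\rangle$ and associated norm $\|\cdot\|_{\mathbb E}$; $\mathbb N=\{0,1,2,\ldots\}$. $\|\cdot\|$ is an arbitrary fixed norm on $\mathbb E$, with dual norm $\|g\|_*:=\sup_{\|s\|\le 1}\langle g,s\rangle$, and $\mathrm{LMO}_{\|\cdot\|}(g):=\operatorname{argmin}_{\|s\|\le 1}\langle g,s\rangle$ (a set). For a nonempty set $\mathcal A\subset\mathbb E$, $P_{\mathcal A}(x):=\operatorname{argmin}_{y\in\mathcal A}\|y-x\|_{\mathbb E}$ is the (possibly set-valued) Euclidean projection. Tangent and normal cones. For $x\in C$, $T_C(x):=\{v\in\mathbb E:\exists\,\tau_j\downarrow 0,\ \exists\,v_j\to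 v\text{ such that }x+\tau_jv_j\in C\}$, and $\widehat N_C(x):=\{w\in\mathbb E:\langle w,v\rangle\le 0\text{ for all }v\in T_C(x)\}$. The set of Bouligand stationary points is $S_B:=\{x\in C:-\nabla f(x)\in\widehat N_C(x)\}$. Ambient return map. Embedded manifolds are without boundary. For $\mathcal M\subset\mathbb E$ a $C^2$ embedded manifold and $x\in\mathcal M$, an ambient return map of $\mathcal M$ at $x$ is a $C^2$ map $\mathcal R_x:\mathcal D_x\to\mathcal M$, where $\mathcal D_x\subset\mathbb E$ is an open neighborhood of $0$, with $\mathcal R_x(0)=x$ and $D\mathcal R_x(0)=P_{T_x\mathcal M}$ (derivatives taken viewing the maps as $\mathbb E$-valued). For $A\subset\mathcal M$, an ambient return map on $A$ is a $C^2$ map $\mathcal R:\mathcal D\to\mathcal M$, where $\mathcal D\subset\mathcal M\times\mathbb E$ is open and contains $A\times\{0\}$, such that for every $x\in A$ the fiber $\mathcal R_x:\mathcal D_x\to\mathcal M$, $\mathcal D_x:=\{u:(x,u)\in\mathcal D\}$, $\mathcal R_x(u):=\mathcal R(x,u)$, is an ambient return map of $\mathcal M$ at $x$. Safe region with return maps. A safe region with return maps for $C$ is a pair $(\Omega,\mathcal R)$, where $\mathcal R=(\mathcal R_x:\mathcal D_x\to C)_{x\in\Omega}$ and each $\mathcal D_x\subset\mathbb E$ is an open neighborhood of $0$, such that: (1) $\Omega\subset C$ is relatively closed in $C$; (2) for every $\bar x\in\Omega$ there exist an open neighborhood $U_{\bar x}\subset\mathbb E$ of $\bar x$ and a $C^3$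 embedded manifold $\mathcal M_{\bar x}\subset\mathbb E$ with $C\cap U_{\bar x}=\mathcal M_{\bar x}\cap U_{\bar x}$, and moreover there is an ambient return map of $\mathcal M_{\bar x}$ on $\Omega\cap U_{\bar x}$ whose fiber at every $x\in\Omega\cap U_{\bar x}$ is a restriction of $\mathcal R_x$. (For $x\in\Omega$, $T_C(x)$ is a linear subspace, so $P_{T_C(x)}$ is a linear projector.) MCSD--PGD algorithm. Input: $x_0\in C$, the norm $\|\cdot\|$ and its LMO, $(\Omega,\mathcal R)$, $\bar\alpha_M,\bar\alpha_P>0$, $c_M,c_P,\beta_M,\beta_P\in(0,1)$. For $t=0,1,2,\ldots$: (a) Stationarity test: if $-\nabla f(x_t)\in\widehat N_C(x_t)$, return $x_t$ (terminal iteration). (b) Smooth branch: otherwise, if $x_t\in\Omega$, set $g_t=P_{T_C(x_t)}\nabla f(x_t)$, choose $s_t\in\mathrm{LMO}_{\|\cdot\|}(g_t)$, and choose the smallest $j\in\mathbb N$ such that $\mathcal R_{x_t}(\bar\alpha_M\beta_M^j s_t)$ is defined and, with $\alpha_t=\bar\alpha_M\beta_M^j$ and $x_{t+1}=\mathcal R_{x_t}(\alpha_ts_t)$, $f(x_{t+1})\le f(x_t)-c_M\alpha_t\|g_t\|_*$. (c) PGD fallback: otherwise, choose the smallest $j\in\mathbb N$ and a corresponding $x_{t+1}$ such that, with $\alpha_t=\bar\alpha_P\beta_P^j$, $x_{t+1}\in P_C(x_t-\alpha_t\nabla f(x_t))$ and $f(x_{t+1})\le f(x_t)+c_P\langle\nabla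 f(x_t),x_{t+1}-x_t\rangle$. *)

(* Defs.v *)
From HB Require Import structures.
From mathcomp Require Import all_boot all_order all_algebra.
From mathcomp Require Import all_classical all_reals all_analysis.
Set Implicit Arguments.
Unset Strict Implicit.
Unset Printing Implicit Defensive.
Import Order.TTheory GRing.Theory Num.Theory.
Import numFieldNormedType.Exports.
Local Open Scope classical_set_scope.
Local Open Scope ring_scope.

#[short(type="normedVectType")]
HB.structure Definition NormedVector (R : numFieldType) :=
  {E of NormedModule R E & Vector R E}.

(* Differentiability classes on an open set [U] of a finite-dimensional space:
   there [x |-> 'd f x] is C^k as an operator-valued map iff all the maps
   [x |-> 'd f x v] are, so no topology on linear maps is needed. *)
Fixpoint Ck (R : realType) (V W : normedModType R) (k : nat) (U : set V)
    (f : V -> W) : Prop :=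
  match k with
  | 0%N => forall x, U x -> {for x, continuous f}
  | k'.+1 => (forall x, U x -> differentiable f x) /\
             (forall v : V, Ck k' U (fun x => 'd f x v))
  end.

(* C^k on a set that need not be open, such as a relatively open subset of an
   embedded manifold: local existence of C^k extensions to the ambient space. *)
Definition Ck_extendable (R : realType) (V W : normedModType R) (k : nat)
    (S : set V) (f : V -> W) : Prop :=
  forall p, S p -> exists (O : set V) (F : V -> W),
    [/\ open O, O p, Ck k O F & forall q, O q -> S q -> F q = f q].

Definition argmin (R : realType) (T : Type) (A : set T) (h : T -> R) : set T :=
  [set x | A x /\ forall y, A y -> h x <= h y].

Definition first_index (P : nat -> Prop) (j : nat) : Prop :=
  P j /\ forall i, (i < j)%N -> ~ P i.

Section Geometry.
Variables (R : realType) (E : normedVectType R).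
Implicit Types (C M A : set E) (x u v : E).

Definition euclid_proj A x : set E := argmin A (fun y => `|y - x|).

Definition tangent_cone C x : set E :=
  [set v | exists (tau : nat -> R) (w : nat -> E),
    [/\ forall j, 0 < tau j, tau @ \oo --> 0, w @ \oo --> v
      & forall j, C (x + tau j *: w j)]].

(* Flattening charts; a single model subspace [L] serves for all points, so the
   dimension is constant. *)
Definition embedded_manifold (k : nat) M : Prop :=
  exists L : {vspace E}, forall x, M x ->
    exists (U V : set E) (phi psi : E -> E),
      [/\ open U /\ U x, open V,
          (forall y, U y -> V (phi y) /\ psi (phi y) = y),
          (forall z, V z -> U (psi z) /\ phi (psi z) = z)
        & [/\ Ck k U phi, Ck k V psi
            & phi @` (M `&` U) = V `&` [set z | z \in L]]].

Definition tangent_space M x : set E :=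
  [set v | exists (I : set R^o) (c : R^o -> E),
    [/\ open I /\ I 0, Ck 1 I c, (forall t, I t -> M (c t)), c 0 = x
      & 'D_1 c 0 = v]].

Definition ambient_return_map M x (D : set E) (r : E -> E) : Prop :=
  [/\ open D /\ D 0, Ck 2 D r, (forall u, D u -> M (r u)), r 0 = x
    & forall u, euclid_proj (tangent_space M x) u = [set 'd r 0 u]].

Definition ambient_return_map_on M A (D : set (E * E)) (r : E * E -> E) : Prop :=
  [/\ (exists2 O : set (E * E), open O & D = O `&` (M `*` setT)),
      (forall x, A x -> D (x, 0)),
      (forall p, D p -> M (r p)),
      Ck_extendable 2 D r
    & forall x, A x ->
        ambient_return_map M x [set u | D (x, u)] (fun u => r (x, u))].

(* [Dom x] and [Ret x] are only meaningful for [x] in [Omega]; [Ret x] is a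
   partial map with domain [Dom x]. *)
Definition safe_region C (Omega : set E) (Dom : E -> set E) (Ret : E -> E -> E)
    : Prop :=
  [/\ (forall x, Omega x ->
         [/\ open (Dom x), Dom x 0 & forall u, Dom x u -> C (Ret x u)]),
      (exists2 F : set E, closed F & Omega = C `&` F)
    & forall xbar, Omega xbar -> exists U M : set E,
        [/\ open U, U xbar, embedded_manifold 3 M, C `&` U = M `&` U
          & exists (D : set (E * E)) (r : E * E -> E),
              ambient_return_map_on M (Omega `&` U) D r /\
              forall x, (Omega `&` U) x -> forall u, D (x, u) ->
                Dom x u /\ Ret x u = r (x, u)]].

Definition is_norm (N : E -> R) : Prop :=
  [/\ forall x y, N (x + y) <= N x + N y,
      forall a x, N (a *: x) = `|a| * N x
    & forall x, N x = 0 -> x = 0].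

Variable ip : {dot E for idfun}.

Definition dual_norm (N : E -> R) (g : E) : R :=
  sup [set ip g s | s in [set s | N s <= 1]].

Definition lmo (N : E -> R) (g : E) : set E :=
  argmin [set s | N s <= 1] (fun s => ip g s).

Definition normal_cone C x : set E :=
  [set w | forall v, tangent_cone C x v -> ip w v <= 0].

(* Riesz representative of ['d f x]. *)
Definition grad (f : E -> R) x : E :=
  xget 0 [set g | forall v, 'd (f : E -> R^o) x v = ip g v].

Definition bouligand_stationary C (f : E -> R) : set E :=
  [set x | C x /\ normal_cone C x (- grad f x)].

End Geometry.

Record mcsd_params (R : realType) := McsdParams {
  alphaM : R; alphaP : R; cM : R; cP : R; betaM : R; betaP : R }.

Definition admissible_params (R : realType) (p : mcsd_params R) : Prop :=
  [/\ 0 < alphaM p, 0 < alphaP p,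
      0 < cM p < 1 /\ 0 < cP p < 1
    & 0 < betaM p < 1 /\ 0 < betaP p < 1].

Section Algorithm.
Variables (R : realType) (E : normedVectType R) (ip : {dot E for idfun}).
Variables (C : set E) (f : E -> R) (N : E -> R).
Variables (Omega : set E) (Dom : E -> set E) (Ret : E -> E -> E).
Variable p : mcsd_params R.
Implicit Types x y g s : E.

Definition smooth_choice x g s : Prop :=
  euclid_proj (tangent_cone C x) (grad ip f x) = [set g] /\ lmo ip N g s.

Definition smooth_trial x g s (j : nat) : Prop :=
  let a := alphaM p * betaM p ^+ j in
  Dom x (a *: s) /\
  f (Ret x (a *: s)) <= f x - cM p * a * dual_norm ip N g.

Definition pgd_trial x (j : nat) y : Prop :=
  euclid_proj C (x - (alphaP p * betaP p ^+ j) *: grad ip f x) y /\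
  f y <= f x + cP p * ip (grad ip f x) (y - x).

Definition smooth_result x g s y : Prop :=
  exists2 j, first_index (smooth_trial x g s) j
           & y = Ret x ((alphaM p * betaM p ^+ j) *: s).

Definition pgd_result x y : Prop :=
  exists2 j, first_index (fun i => exists z, pgd_trial x i z) j
           & pgd_trial x j y.

Definition terminal x : Prop := normal_cone ip C x (- grad ip f x).

Definition mcsd_step x y : Prop :=
  ~ terminal x /\
  ((Omega x /\ exists g s, smooth_choice x g s /\ smooth_result x g s y) \/
   (~ Omega x /\ pgd_result x y)).

(* A maximal execution: [X t = Some x_t] as long as iteration [t] takes place.
   It goes on whenever some next iterate exists; it stops (value [None]) when
   there is none, either because the stationarity test succeeded or because no
   admissible choice leads to a next iterate. *)
Definition mcsd_run (x0 : E) (X : nat -> option E) : Prop :=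
  X 0%N = Some x0 /\
  forall t, match X t with
            | None => X t.+1 = None
            | Some x =>
                (exists2 y, mcsd_step x y & X t.+1 = Some y) \/
                ((forall y, ~ mcsd_step x y) /\ X t.+1 = None)
            end.

(* The line search applicable at [x] stops, for every admissible choice of
   [g] and [s], at a finite number of reductions, and all the next iterates it
   may produce are in [C]. *)
Definition line_search_succeeds x : Prop :=
  (Omega x ->
     (exists g s, smooth_choice x g s) /\
     forall g s, smooth_choice x g s ->
       (exists j, first_index (smooth_trial x g s) j) /\
       (forall y, smooth_result x g s y -> C y)) /\
  (~ Omega x ->
     (exists j, first_index (fun i => exists z, pgd_trial x i z) j) /\
     (forall y, pgd_result x y -> C y)).

End Algorithm.

(* Main.v *)
From HB Require Import structures.
Require Import Defs.
From mathcomp Require Import all_boot all_order all_algebra.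
From mathcomp Require Import all_classical all_reals all_analysis.
From mathcomp Require Import ring lra.
Set Implicit Arguments.
Unset Strict Implicit.
Unset Printing Implicit Defensive.
Import Order.TTheory GRing.Theory Num.Theory.
Import passmx.
Import numFieldNormedType.Exports.
Local Open Scope classical_set_scope.
Local Open Scope ring_scope.

(** The proof rests on one statement about a single point: if [z] in [C] is not
    Bouligand stationary, there are [r, d > 0] such that every step taken from a
    point of [C] within [r] of [z] decreases [f] by at least [d]
    ([step_uniform_decrease]).  As the values of [f] along a run decrease,
    such a [z] cannot be an accumulation point ([accumulation_stationary]).

    For both branches the statement is obtained by finding a threshold [a0],
    uniform near [z], such that all trial steps in ]0, a0] are accepted.  Taken
    at [z] equal to the current iterate, it says that the search stops
    ([backtracking_stops]); near a fixed [z] it bounds the accepted step from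
    below ([backtracking_step_ge]).  It then remains to bound from below the
    decrease predicted by the Armijo condition.

    For a projected gradient step, [y] being a projection of [x - a g] on [C]
    with [g] the gradient at [x], minimality of the distance says that
    [`|y - x|^2 + 2 a <g, y - x> <= `|w - x|^2 + 2 a <g, w - x>] for all [w] in
    [C].  The choice [w = x] shows that short steps satisfy the Armijo condition
    ([pgd_armijo_near]).  The choice of a fixed [w] near [z], in a tangent
    direction along which [f] decreases, bounds [<g, y - x>] away from 0
    ([pgd_uniform_decrease]).

    For a smooth step, [C] is a manifold near [z].  Its tangent cones are the
    tangent spaces, on which the differential of the return map at 0 is the
    orthogonal projector ([return_map_extension]).  Hence the slope of [f] along
    the return map in a direction [s] is [<g, s>], with [g] the projected
    gradient; for [s] chosen by the linear minimization oracle it equals minus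
    the dual norm of [g].  Stationarity fails at [z], so this dual norm is
    bounded below near [z]; and since the return maps are C^1 jointly in the
    base point and the displacement, the slopes along short steps are close to
    the initial slope, uniformly in the base point and the direction
    ([smooth_search_near]).

    The analysis in [E] needs the usual facts of finite dimension: equivalence
    of norms, compactness of closed bounded sets, continuity of linear maps and
    uniformity of pointwise convergence of linear maps. *)

(** * Finite-dimensional normed spaces *)

Lemma bounded_slope_continuous (R : realType) (V W : normedModType R)
    (h : V -> W) (K : R) : 0 < K ->
  (forall x y, `|h x - h y| <= K * `|x - y|) -> continuous h.
Proof.
move=> K0 hK x; apply/cvgrPdist_lt => e e0; near=> y.
apply: (le_lt_trans (hK _ _)); rewrite -ltr_pdivlMl//.
by near: y; apply: cvgr_dist_lt => //; rewrite mulr_gt0// invr_gt0.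
Unshelve. all: by end_near. Qed.

Section NormBasics.
Variables (R : realType) (E : normedVectType R) (N : E -> R).
Hypothesis N_norm : is_norm N.

Lemma is_norm0 : N 0 = 0.
Proof. by case: N_norm => _ NZ _; rewrite -(scale0r 0) NZ normr0 mul0r. Qed.

Lemma is_normN x : N (- x) = N x.
Proof. by case: N_norm => _ NZ _; rewrite -scaleN1r NZ normrN1 mul1r. Qed.

Lemma is_norm_ge0 x : 0 <= N x.
Proof.
have [ND _ _] := N_norm; have := ND x (- x).
by rewrite subrr is_norm0 is_normN; lra.
Qed.

Lemma is_norm_dist x y : `|N x - N y| <= N (x - y).
Proof.
have [ND _ _] := N_norm.
have := ND (x - y) y; have := ND (y - x) x; rewrite !subrK -(opprB x) is_normN.
by rewrite ler_norml => ? ?; apply/andP; split; lra.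
Qed.

End NormBasics.

Section FiniteDimension.
Variables (R : realType) (E : normedVectType R).

Local Notation crd := (rVof (vbasis {:E})).
Local Notation vec := (vecof (vbasis {:E})).
Let crdK : cancel crd vec := rVofK (vbasisP {:E}).
Let vecK : cancel vec crd := vecofK (vbasisP {:E}).

(** Expanding a vector in the basis [vbasis {:E}] bounds any seminorm by its
    values on the basis.  The constant is kept explicit because it has to tend
    to 0 along with the seminorm in [seminorm_cvg_uniform]. *)
Lemma seminorm_le_basis (g : E -> R) :
    (forall x y, g (x + y) <= g x + g y) ->
    (forall a x, g (a *: x) = `|a| * g x) ->
  forall x, g x <= (\sum_(i < \dim {:E}) g (vbasis {:E})`_i) * `|crd x|.
Proof.
move=> gD gZ x.
have g0 : g 0 = 0 by rewrite -(scale0r (0 : E)) gZ normr0 mul0r.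
have g_ge0 y : 0 <= g y.
  have := gD y (- y); rewrite subrr g0 -scaleN1r gZ normrN1 mul1r; lra.
have gsum (I : Type) (r : seq I) (F : I -> E) :
    g (\sum_(i <- r) F i) <= \sum_(i <- r) g (F i).
  elim: r => [|i r IH]; first by rewrite !big_nil g0.
  by rewrite !big_cons (le_trans (gD _ _))// lerD2l.
rewrite -{1}(crdK x) (le_trans (gsum _ _ _))// mulr_suml.
apply: ler_sum => i _; rewrite gZ mulrC ler_wpM2l//.
rewrite [leRHS]/Num.Def.normr/= mx_normrE.
by apply/bigmax_geP; right; exists (0, i).
Qed.

Lemma seminorm_le_coord (g : E -> R) :
    (forall x y, g (x + y) <= g x + g y) ->
    (forall a x, g (a *: x) = `|a| * g x) ->
  exists2 K : R, 0 < K & forall x, g x <= K * `|crd x|.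
Proof.
move=> gD gZ; set S := \sum_(i < \dim {:E}) g (vbasis {:E})`_i.
exists (`|S| + 1) => [|x]; first by rewrite ltr_pwDr.
rewrite (le_trans (seminorm_le_basis gD gZ x))// ler_wpM2r//.
by rewrite (le_trans (ler_norm _))// lerDl.
Qed.

(** The norm, read in coordinates, is continuous and positive on the compact
    unit sphere of the row vectors, hence has a positive minimum there.  When
    [E = 0] that sphere is empty and any constant will do. *)
Lemma norm_coord_equiv (N : E -> R) : is_norm N ->
  exists2 m, 0 < m & forall x, m * `|crd x| <= N x.
Proof.
move=> NN; have [ND NZ N0] := NN.
have [K K0 NK] := seminorm_le_coord ND NZ.
pose S : set 'rV[R]_(\dim {:E}) := [set a | `|a| = 1].
have [S0|] := pselect (S !=set0); last first.
  move=> /set0P/negP; rewrite negbK => /eqP S0; exists 1 => // x.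
  suff -> : crd x = 0 by rewrite normr0 mulr0 is_norm_ge0.
  apply/eqP/negPn/negP => x0.
  have : S (`|crd x|^-1 *: crd x).
    by rewrite /S/= normrZ normfV normr_id mulVf ?normr_eq0.
  by rewrite S0.
have Sc : compact S.
  apply: bounded_closed_compact.
    by exists 1; split => // M M1 a; rewrite /S/= => ->; exact: ltW.
  rewrite [S](_ : _ = Num.norm @^-1` [set 1]); last by [].
  apply: preimage_closed; first by move=> ? ?; exact: norm_continuous.
  exact: closed_eq.
have Nc : continuous (fun a => N (vec a)).
  apply: (@bounded_slope_continuous _ _ R^o _ K K0) => a b.
  apply: (le_trans (is_norm_dist NN _ _)).
  by rewrite -linearB (le_trans (NK _))// vecK.
have [c cS cmin] := compact_EVT_min S0 Sc (continuous_subspaceT Nc).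
rewrite inE in cS.
have c_gt0 : 0 < N (vec c).
  rewrite lt_neqAle (is_norm_ge0 NN) andbT eq_sym; apply/eqP => /N0 c0.
  move: cS; rewrite /S/= -(vecK c) c0 linear0 normr0 => /eqP.
  by rewrite eq_sym oner_eq0.
exists (N (vec c)) => // x.
have [->|x0] := eqVneq x 0; first by rewrite linear0 normr0 mulr0 is_norm_ge0.
have vx0 : `|crd x| != 0.
  rewrite normr_eq0; apply: contra_neq x0 => vx0.
  by apply: (can_inj crdK); rewrite vx0 linear0.
have /cmin : (`|crd x|^-1 *: crd x) \in S.
  by rewrite inE /S/= normrZ normfV normr_id mulVf.
rewrite linearZ/= crdK NZ normfV normr_id.
by rewrite mulrC ler_pdivlMr// lt_neqAle eq_sym vx0 normr_ge0.
Qed.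

Lemma norm_is_norm : is_norm (fun x : E => `|x|).
Proof.
by split; [exact: ler_normD|exact: normrZ|exact: normr0_eq0].
Qed.

Lemma norm_equiv (N : E -> R) : is_norm N ->
  exists2 K, 0 < K & forall x, `|x| <= K * N x /\ N x <= K * `|x|.
Proof.
move=> NN; have [ND NZ _] := NN.
have [K K0 NK] := seminorm_le_coord ND NZ.
have [m m0 mN] := norm_coord_equiv NN.
have [K' K'0 NK'] := seminorm_le_coord (@ler_normD _ E) (@normrZ _ E).
have [m' m'0 mN'] := norm_coord_equiv norm_is_norm.
exists (K' / m + K / m'); first by rewrite addr_gt0// divr_gt0.
move=> x; have Nx : 0 <= N x.
  by rewrite (le_trans _ (mN x))// mulr_ge0// ltW.
split.
  apply: (le_trans (NK' _)).
  rewrite mulrDl -[leLHS]addr0 lerD//; last first.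
    by rewrite mulr_ge0// ltW// divr_gt0.
  by rewrite -mulrA ler_wpM2l ?(ltW K'0)// ler_pdivlMl.
apply: (le_trans (NK _)).
rewrite mulrDl -[leLHS]add0r lerD//.
  by rewrite mulr_ge0// ltW// divr_gt0.
by rewrite -mulrA ler_wpM2l ?(ltW K0)// ler_pdivlMl.
Qed.

(** In finite dimension pointwise convergence to 0 of seminorms is uniform on
    bounded sets.  It is applied to differences of differentials, for which
    class C^1 only gives pointwise convergence. *)
Lemma seminorm_cvg_uniform (T : Type) (F : set_system T) (FF : Filter F)
    (g : T -> E -> R) :
    (forall t x y, g t (x + y) <= g t x + g t y) ->
    (forall t a x, g t (a *: x) = `|a| * g t x) ->
    (forall x, g t x @[t --> F] --> 0) ->
  forall e, 0 < e -> \forall t \near F, forall x, g t x <= e * `|x|.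
Proof.
move=> gD gZ g0 e e0.
have [m m0 mN] := norm_coord_equiv norm_is_norm.
have S0 : (\sum_(i < \dim {:E}) g t (vbasis {:E})`_i) @[t --> F] --> 0.
  have := @cvg_big R _ +%R 0 predT (@add_continuous R) T F
    (index_enum 'I_(\dim {:E})) (fun i t => g t (vbasis {:E})`_i) (fun=> 0) FF.
  by rewrite big1//; apply => i _; exact: g0.
have : \forall t \near F, \sum_(i < \dim {:E}) g t (vbasis {:E})`_i < e * m.
  by apply: (cvgr_lt _ S0); rewrite mulr_gt0.
apply: filterS => t St x.
rewrite (le_trans (seminorm_le_basis (gD t) (gZ t) x))//.
apply: (@le_trans _ _ (e * m * `|crd x|)); first by rewrite ler_wpM2r// ltW.
by rewrite -mulrA ler_wpM2l// ltW.
Qed.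

Lemma linear_continuous_findim (W : normedModType R) (l : {linear E -> W}) :
  continuous l.
Proof.
apply: bounded_linear_continuous; apply/linear_boundedP.
have [||K K0 lK] := @seminorm_le_coord (fun x => `|l x|).
- by move=> x y; rewrite linearD ler_normD.
- by move=> a x; rewrite linearZ normrZ.
have [m m0 mN] := norm_coord_equiv norm_is_norm.
near=> r => x; apply: (le_trans (lK _)).
apply: (@le_trans _ _ (K / m * `|x|)).
  by rewrite -mulrA ler_wpM2l ?(ltW K0)// ler_pdivlMl.
by rewrite ler_wpM2r//; near: r; exact: nbhs_pinfty_ge.
Unshelve. all: by end_near. Qed.

(** Coordinates carry the Heine-Borel theorem over from row vectors. *)
Lemma bounded_closed_compact_findim (A : set E) :
  bounded_set A -> closed A -> compact A.
Proof.
move=> Ab Acl.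
have [K K0 NK'] := seminorm_le_coord (@ler_normD _ E) (@normrZ _ E).
have [m m0 mN] := norm_coord_equiv norm_is_norm.
have rc : continuous vec.
  apply: (@bounded_slope_continuous _ _ _ _ K K0) => a b.
  by rewrite -linearB (le_trans (NK' _))// vecK.
have -> : A = vec @` (vec @^-1` A).
  apply/seteqP; split => [x Ax|_ [a Aa <-]//].
  by exists (crd x); rewrite /= crdK.
apply: continuous_compact; first exact: continuous_subspaceT.
apply: bounded_closed_compact; last first.
  by apply: preimage_closed => // x _; exact: rc.
have [M [Mr AM]] := Ab.
exists (m^-1 * (`|M| + 1)); split; first exact: num_real.
move=> r rM a /= Aa.
have aM : `|vec a| <= `|M| + 1.
  by apply: AM Aa; rewrite (le_lt_trans (ler_norm M))// ltrDl.
apply/ltW/(le_lt_trans _ rM); rewrite ler_pdivlMl//.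
by apply: le_trans aM; have := mN (vec a); rewrite vecK.
Qed.

(** A subspace is the zero set of [id - projv L], a linear and therefore
    continuous map. *)
Lemma vspace_closed (L : {vspace E}) : closed [set z | z \in L].
Proof.
have -> : [set z | z \in L] = (fun z => z - projv L z) @^-1` [set 0].
  apply/seteqP; split => z /=.
    by move=> zL; rewrite projv_id ?subrr.
  by move/eqP; rewrite subr_eq0 => /eqP ->; exact: memv_proj.
apply: preimage_closed; last first.
  exact/accessible_closed_set1/hausdorff_accessible/norm_hausdorff.
move=> x _; apply: continuousB; first exact: cvg_id.
exact: linear_continuous_findim.
Qed.

Lemma argmin_nonempty_compact (A : set E) (h : E -> R) :
  A !=set0 -> compact A -> continuous h -> argmin A h !=set0.
Proof.
move=> A0 Ac hc.
have [c cA cmin] := compact_EVT_min A0 Ac (continuous_subspaceT hc).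
by exists c; split; [exact: set_mem|move=> y Ay; apply/cmin/mem_set].
Qed.

(** Only the points of [A] no farther from [x] than a given point of [A]
    compete, and they form a compact set. *)
Lemma euclid_proj_nonempty (A : set E) (x : E) :
  A !=set0 -> closed A -> euclid_proj A x !=set0.
Proof.
move=> [a Aa] Acl.
pose B := A `&` [set y | `|y - x| <= `|a - x|].
have cd : continuous (fun y : E => `|y - x|).
  by move=> y; apply: cvg_norm; apply: cvgB; [exact: cvg_id|exact: cvg_cst].
have [||y [[Ay _] ymin]] := @argmin_nonempty_compact B _ _ _ cd.
- by exists a; split => //=.
- apply: bounded_closed_compact_findim.
    exists (`|a - x| + `|x|); split; first exact: num_real.
    move=> r rM y [_ /= yx]; apply: le_trans (ltW rM).
    by rewrite -{1}(subrK x y) (le_trans (ler_normD _ _))// lerD2r.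
  apply: closedI => //.
  rewrite [X in closed X](_ : _ =
    (fun y => `|y - x|) @^-1` [set t | t <= `|a - x|]); last by [].
  by apply: preimage_closed; [move=> ? _; exact: cd|exact: closed_le].
exists y; split => // z Az.
have [zx|/ltW zx] := lerP `|z - x| `|a - x|; first exact: ymin.
by apply: le_trans zx; apply: ymin; split => /=.
Qed.

End FiniteDimension.

(** * Inner product, gradients and the mean value theorem *)

Section InnerProduct.
Variables (R : realType) (E : normedVectType R) (ip : {dot E for idfun}).
Hypothesis ip_norm : forall x : E, ip x x = `|x| ^+ 2.

Lemma ipC (x y : E) : ip x y = ip y x.
Proof. by rewrite hermC expr0 mul1r. Qed.

Lemma ipDr (x y z : E) : ip x (y + z) = ip x y + ip x z.
Proof. exact: linearDr. Qed.
Lemma ipDl (x y z : E) : ip (x + y) z = ip x z + ip y z.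
Proof. exact: linearDl. Qed.
Lemma ipNr (x y : E) : ip x (- y) = - ip x y.
Proof. exact: linearNr. Qed.
Lemma ipNl (x y : E) : ip (- x) y = - ip x y.
Proof. exact: linearNl. Qed.
Lemma ipZl (a : R) (x y : E) : ip (a *: x) y = a * ip x y.
Proof. exact: linearZl. Qed.
Lemma ipZr (a : R) (x y : E) : ip x (a *: y) = a * ip x y.
Proof. exact: linearZr. Qed.
Lemma ip0r (x : E) : ip x 0 = 0.
Proof. exact: linear0r. Qed.

Definition ipE := (ipDr, ipDl, ipNr, ipNl, ipZl, ipZr).

Lemma sqr_normD (x y : E) :
  `|x + y| ^+ 2 = `|x| ^+ 2 + 2 * ip x y + `|y| ^+ 2.
Proof. by rewrite -!ip_norm !ipE (ipC y x); ring. Qed.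

Lemma ip_le_norm (x y : E) : `|ip x y| <= `|x| * `|y|.
Proof.
suff H z : ip z y <= `|z| * `|y|.
  by rewrite ler_norml H andbT lerNl -ipNl (le_trans (H _))// normrN.
have [->|z0] := eqVneq z 0; first by rewrite normr0 mul0r ipC ip0r.
have := sqr_ge0 `| `|z| *: y - `|y| *: z|.
rewrite sqr_normD !normrN !normrZ !normr_id !ipE (ipC y z).
have z1 : 0 < `|z| by rewrite normr_gt0.
have [->|y0] := eqVneq y 0; first by rewrite ip0r normr0 mulr0.
have y1 : 0 < `|y| by rewrite normr_gt0.
move=> H; have {}H : 0 <= (`|z| * `|y|) * (`|z| * `|y| - ip z y) by nra.
by rewrite -subr_ge0; rewrite pmulr_rge0 ?mulr_gt0 in H.
Qed.

(** Polarization reduces joint continuity of the inner product to continuity of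
    the norm. *)
Lemma ip_cvg (T : Type) (F : set_system T) (FF : Filter F) (u v : T -> E)
    (a b : E) : u @ F --> a -> v @ F --> b ->
  (fun t => ip (u t) (v t)) @ F --> ip a b.
Proof.
move=> ua vb.
have polar x y : ip x y = (`|x + y| ^+ 2 - `|x| ^+ 2 - `|y| ^+ 2) / 2.
  by rewrite sqr_normD; field.
rewrite (_ : (fun t => _) = fun t =>
  (`|u t + v t| ^+ 2 - `|u t| ^+ 2 - `|v t| ^+ 2) / 2); last first.
  by apply/funext => t; rewrite polar.
rewrite polar; apply: cvgM; last exact: cvg_cst.
apply: cvgB; first apply: cvgB.
- by apply: cvgM; apply: cvg_norm; exact: cvgD.
- by apply: cvgM; exact: cvg_norm.
- by apply: cvgM; exact: cvg_norm.
Qed.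

Lemma ip_continuous (x : E) : continuous (ip x : E -> R^o).
Proof. by move=> y; apply: ip_cvg; [exact: cvg_cst|exact: cvg_id]. Qed.

(** The map [g |-> ip g] from [E] to its dual is linear and, the form being
    definite, injective; the dimensions agree, so it is onto. *)
Lemma riesz_representation (l : {linear E -> R^o}) :
  exists g, forall v, l v = ip g v.
Proof.
pose ipl (g : E) : E -> R^o := ip g.
have ipl_lin g : linear (ipl g) by move=> a x y; rewrite /ipl ipDr ipZr.
pose iplM g := GRing.isLinear.Build R E R^o *:%R (ipl g) (ipl_lin g).
pose iplL g : {linear E -> R^o} := HB.pack (ipl g) (iplM g).
pose T (g : E) : 'Hom(E, R^o) := linfun (iplL g).
have T_lin : linear T.
  move=> a x y; apply/lfunP => v; rewrite add_lfunE scale_lfunE !lfunE /= /ipl.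
  by rewrite ipDl ipZl.
pose TM := GRing.isLinear.Build R E 'Hom(E, R^o) *:%R T T_lin.
pose TL : {linear E -> 'Hom(E, R^o)} := HB.pack T TM.
have Tinj : lker (linfun TL) == 0%VS.
  apply/lker0P => x y; rewrite !lfunE/= => /lfunP /(_ (x - y)).
  rewrite !lfunE /= /ipl => /eqP.
  rewrite -subr_eq0 -ipNl -ipDl ip_norm sqrf_eq0 normr_eq0 subr_eq0.
  by move=> /eqP.
have : linfun l \in limg (linfun TL).
  suff -> : limg (linfun TL) = fullv by exact: memvf.
  apply/eqP; rewrite eqEdim subvf limg_dim_eq ?(eqP Tinj) ?capv0//.
  rewrite !dimvf /= -[leqRHS]muln1; exact: leqnn.
move=> /memv_imgP [g _ /lfunP lg]; exists g => v.
have := lg v; rewrite lfunE /= => ->.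
have /(congr1 (fun h : 'Hom(E, R^o) => h v)) -> := lfunE TL g.
by rewrite lfunE.
Qed.

(** [grad] is defined by choice with default value 0; the Riesz representation
    shows that the default is never taken. *)
Lemma gradP (f : E -> R) (x v : E) :
  'd (f : E -> R^o) x v = ip (grad ip f x) v.
Proof.
rewrite /grad; case: xgetP => [g _ ->//|no_g].
by have [g /(no_g g)] := riesz_representation ('d (f : E -> R^o) x).
Qed.

End InnerProduct.

Lemma diff_line (R : realType) (V W : normedModType R) (h : V -> W)
    (a v : V) (t : R) : differentiable h (a + t *: v) ->
  is_diff (t : R^o) (fun s : R^o => h (a + s *: v))
    (fun s : R^o => 'd h (a + t *: v) (s *: v)).
Proof.
move=> dh.
pose g (s : R^o) := a + s *: v.
have dg : is_diff (t : R^o) g (fun s => s *: v).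
  have := is_diffD (is_diff_cst a (t : R^o)) (is_diff_scalel t v).
  by rewrite add0r.
by have := @is_diff_comp _ _ _ _ g _ h _ t dg (differentiableP dh).
Qed.

Lemma mean_value_segment (R : realType) (V : normedModType R) (h : V -> R^o)
    (a v : V) :
    (forall t, 0 <= t <= 1 -> differentiable h (a + t *: v)) ->
  exists2 t, 0 <= t <= 1 & h (a + v) - h a = 'd h (a + t *: v) v.
Proof.
move=> dh.
pose phi (t : R^o) : R^o := h (a + t *: v).
have dphi (t : R^o) : 0 <= t <= 1 ->
    is_diff t phi (fun s : R^o => 'd h (a + t *: v) (s *: v)).
  by move=> /dh; exact: diff_line.
have [||t t01] := @MVT_segment R phi (fun t => 'd h (a + t *: v) v) 0 1 ler01.
- move=> t; rewrite in_itv/= => /andP[t0 t1].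
  have t01 : 0 <= t <= 1 by rewrite !ltW.
  have dt := dphi t t01.
  apply: DeriveDef; first exact/diff_derivable/ex_diff.
  by rewrite deriveE; [rewrite diff_val scale1r|exact: ex_diff].
- apply: continuous_in_subspaceT => t.
  rewrite inE/= in_itv/= => /dphi dt.
  exact/differentiable_continuous/ex_diff.
rewrite in_itv/= in t01.
by rewrite /phi scale1r scale0r addr0 subr0 mulr1 => ?; exists t.
Qed.

(** * Backtracking *)

Lemma first_index_exists (P : nat -> Prop) :
  (exists j, P j) -> exists j, first_index P j.
Proof.
move=> [j Pj].
have Q : exists j, `[< P j >] by exists j; exact/asboolP.
case: (ex_minnP Q) => i /asboolP Pi mini; exists i; split => // k ki Pk.
by have := mini k (introT (asboolP _) Pk); rewrite leqNgt ki.
Qed.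

(** If all steps in ]0, astar] are acceptable, the step size accepted by a
    backtracking search is at least [min abar (b * astar)]: either the first
    trial is accepted or the last rejected one exceeded [astar].  This bound is
    what makes the decrease uniform when [astar] is uniform. *)
Section Backtracking.
Variables (R : realType) (abar b astar : R) (P : R -> Prop).
Hypotheses (abar0 : 0 < abar) (b01 : 0 < b < 1) (astar0 : 0 < astar).
Hypothesis Psmall : forall a, 0 < a <= astar -> P a.

Lemma backtracking_stops : exists j, first_index (fun j => P (abar * b ^+ j)) j.
Proof.
have [b0 b1] := andP b01.
apply: first_index_exists.
have bn : (fun j => b ^+ j) @ \oo --> (0 : R).
  by apply: cvg_expr; rewrite ger0_norm// ltW.
have : \forall j \near \oo, b ^+ j < astar / abar.
  by apply: (cvgr_lt _ bn); exact: divr_gt0.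
case=> j _ /(_ j (leqnn j)) /= bj; exists j; apply: Psmall.
rewrite mulr_gt0 ?exprn_gt0//=; apply: ltW.
by rewrite mulrC -ltr_pdivlMr.
Qed.

Lemma backtracking_step_ge j : first_index (fun j => P (abar * b ^+ j)) j ->
  Num.min abar (b * astar) <= abar * b ^+ j.
Proof.
have [b0 b1] := andP b01.
move=> [_ minj]; rewrite ge_min; case: j minj => [|j] minj.
  by rewrite expr0 mulr1 lexx.
apply/orP; right; rewrite exprS mulrCA ler_pM2l// leNgt; apply/negP => /ltW H.
apply: (minj j (ltnSn j)); apply: Psmall; rewrite H andbT.
by rewrite mulr_gt0 ?exprn_gt0.
Qed.

End Backtracking.

(** * Projected gradient steps *)

Section ProjectedGradient.
Variables (R : realType) (E : normedVectType R) (ip : {dot E for idfun}).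
Hypothesis ip_norm : forall x : E, ip x x = `|x| ^+ 2.

Variables (C : set E) (f : E -> R).
Hypothesis f_C1 : Ck 1 setT (f : E -> R^o).
Hypothesis grad_loc_lip : forall x : E,
  exists2 U : set E, nbhs x U & [lipschitz (grad ip f y) | y in U].

Lemma grad_lipschitz_ball z : exists r L : R, [/\ 0 < r, 0 < L &
  forall x y, `|x - z| < r -> `|y - z| < r ->
    `|grad ip f y - grad ip f x| <= L * `|y - x|].
Proof.
have [U /nbhs_normP [r /= r0 rU] [M [Mr ML]]] := grad_loc_lip z.
exists r, (`|M| + 1); split; [by []|by apply: ltr_wpDl|].
move=> x y xz yz.
have MM : M < `|M| + 1 by rewrite (le_lt_trans (ler_norm M))// ltrDl.
by apply: (ML _ MM (y, x)); split => /=; apply: rU; rewrite /= distrC.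
Qed.

Lemma grad_continuous : continuous (grad ip f).
Proof.
move=> z; have [r [L [r0 L0 H]]] := grad_lipschitz_ball z.
apply/cvgrPdist_lt => e e0; near=> y.
have yz : `|y - z| < r.
  by rewrite distrC; near: y; apply: cvgr_dist_lt.
apply: (le_lt_trans (H y z yz _)); first by rewrite subrr normr0.
rewrite -ltr_pdivlMl//; near: y; apply: cvgr_dist_lt => //.
by rewrite mulr_gt0// invr_gt0.
Unshelve. all: by end_near. Qed.

(** The mean value theorem puts the gradient at an intermediate point, which the
    Lipschitz bound compares with the gradient at [x].  The radius is a third of
    the Lipschitz radius so that the whole segment stays in the Lipschitz ball. *)
Lemma descent_inequality z : exists r L : R, [/\ 0 < r, 0 < L &
  forall x y, `|x - z| < r -> `|y - z| < r ->
    `|grad ip f x| <= L /\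
    f y <= f x + ip (grad ip f x) (y - x) + L * `|y - x| ^+ 2].
Proof.
have [r [L [r0 L0 H]]] := grad_lipschitz_ball z.
(* L for the quadratic term, L * r + `|grad f z| for the gradient bound *)
pose L' := L + L * r + `|grad ip f z|.
exists (r / 3), L'; split; first exact: divr_gt0.
  by rewrite /L' ltr_pwDl// ?ltr_pwDl// ?mulr_ge0// ltW.
move=> x y xz yz.
have xz' : `|x - z| < r by move: xz r0; lra.
split.
  rewrite -(subrK (grad ip f z) (grad ip f x)) (le_trans (ler_normD _ _))//.
  rewrite lerD2r (le_trans (H _ _ _ xz')) ?subrr ?normr0//.
  by rewrite ler_wpDl ?ler_wpM2l// ltW.
have [|t /andP[t0 t1]] := @mean_value_segment _ _ (f : E -> R^o) x (y - x).
  by move=> t _; case: f_C1 => + _; exact.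
rewrite (gradP ip_norm) subrKC => fxy.
have tz : `|x + t *: (y - x) - z| < r.
  rewrite addrAC (le_lt_trans (ler_normD _ _))// normrZ ger0_norm//.
  have : t * `|y - x| <= `|y - x| by rewrite ler_piMl.
  have : `|y - x| <= `|y - z| + `|x - z|.
    by rewrite -[y - x](subrKA z) -(opprB x z) (le_trans (ler_normB _ _)).
  by move: xz yz; lra.
have Hg : `|grad ip f (x + t *: (y - x)) - grad ip f x| <= L * (t * `|y - x|).
  have <- : `|x + t *: (y - x) - x| = t * `|y - x|.
    by rewrite (addrC x) addrK normrZ ger0_norm.
  exact: H xz' tz.
rewrite -lerBlDl opprD addrA fxy -(subrK (grad ip f x) (grad ip f (x + _))).
rewrite ipDl addrK (le_trans (ler_norm _))//.
rewrite (le_trans (ip_le_norm ip_norm _ _))// expr2 mulrA ler_wpM2r//.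
apply: (le_trans Hg); apply: (@le_trans _ _ (L * `|y - x|)).
  by rewrite ler_wpM2l ?(ltW L0)// ler_piMl.
by rewrite ler_wpM2r// /L' -addrA lerDl addr_ge0// mulr_ge0 ?ltW.
Qed.

(** Expansion of the two squared distances to [x - a *: g] in the minimality of
    [y]; the common term [`|a *: g| ^+ 2] cancels. *)
Lemma euclid_proj_ineq (x g y w : E) (a : R) : C w ->
    euclid_proj C (x - a *: g) y ->
  `|y - x| ^+ 2 + 2 * a * ip g (y - x) <= `|w - x| ^+ 2 + 2 * a * ip g (w - x).
Proof.
move=> Cw [_ /(_ _ Cw)].
have sq u : `|u - (x - a *: g)| ^+ 2 =
    `|u - x| ^+ 2 + 2 * a * ip g (u - x) + `|a *: g| ^+ 2.
  by rewrite opprB addrCA addrC (sqr_normD ip_norm) ipZr (ipC ip (u - x)); ring.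
by rewrite -(@ler_pXn2r _ 2) ?nnegrE// !sq lerD2r.
Qed.

Lemma euclid_proj_self (x g y : E) (a : R) : C x ->
  euclid_proj C (x - a *: g) y -> `|y - x| ^+ 2 + 2 * a * ip g (y - x) <= 0.
Proof.
move=> Cx /(euclid_proj_ineq Cx).
by rewrite subrr normr0 ip0r expr0n mulr0 addr0.
Qed.

(** Comparing the projection with [x] itself gives
    [`|y - x| ^+ 2 <= - 2 a <g, y - x>], so the quadratic error of the descent
    inequality is at most [2 a L] times the predicted decrease, and small steps
    satisfy the Armijo condition.  The same inequality gives
    [`|y - x| <= 2 a L], which keeps [y] in the ball where the descent
    inequality is valid. *)
Lemma pgd_armijo_near (c : R) z : c < 1 ->
  exists r a0 : R, [/\ 0 < r, 0 < a0 &
  forall x a y, C x -> `|x - z| < r -> 0 < a <= a0 ->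
    euclid_proj C (x - a *: grad ip f x) y ->
    f y <= f x + c * ip (grad ip f x) (y - x)].
Proof.
move=> c1; have [r [L [r0 L0 H]]] := descent_inequality z.
(* the first bound keeps y within r of z, the second gives 2 a L <= 1 - c *)
exists (r / 2), (Num.min (r / (4 * L)) ((1 - c) / (2 * L))); split.
- by rewrite divr_gt0.
- by rewrite lt_min !divr_gt0 ?mulr_gt0 ?subr_gt0.
move=> x a y Cx xz /andP[a0]; rewrite le_min !ler_pdivlMr ?mulr_gt0//.
move=> /andP[ar ac] /(euclid_proj_self Cx) yx.
have xz' : `|x - z| < r by move: xz r0; lra.
have gL : `|grad ip f x| <= L.
  by have [] := H x x xz' xz'.
have yxa : `|y - x| <= 2 * a * L.
  have [->|yx0] := eqVneq y x; first by rewrite subrr normr0 !mulr_ge0 ?ltW.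
  have d0 : 0 < `|y - x| by rewrite normr_gt0 subr_eq0.
  rewrite -(ler_pM2l d0) -expr2.
  have : - ip (grad ip f x) (y - x) <= L * `|y - x|.
    rewrite -ipNl (le_trans (ler_norm _))//.
    by rewrite (le_trans (ip_le_norm ip_norm _ _))// normrN ler_wpM2r.
  move=> /(ler_wpM2l (ltW a0)); move: yx; lra.
have yz : `|y - z| < r.
  rewrite -(subrKA x) (le_lt_trans (ler_normD _ _))//.
  by move: xz yxa ar; lra.
have [_ fy] := H x y xz' yz.
apply: (le_trans fy); rewrite -addrA lerD2l.
have ip_le0 : ip (grad ip f x) (y - x) <= 0.
  rewrite -(pmulr_rle0 _ (_ : 0 < 2 * a)) ?mulr_gt0//.
  by apply: le_trans yx; rewrite lerDr sqr_ge0.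
have : L * `|y - x| ^+ 2 <= L * (2 * a * (- ip (grad ip f x) (y - x))).
  by rewrite ler_wpM2l ?(ltW L0)//; move: yx; lra.
have : (a * (2 * L)) * (- ip (grad ip f x) (y - x)) <=
       (1 - c) * (- ip (grad ip f x) (y - x)).
  by rewrite ler_wpM2r ?oppr_ge0.
lra.
Qed.

Variable p : mcsd_params R.
Hypothesis p_ok : admissible_params p.
Hypothesis C_closed : closed C.

Lemma pgd_search_near z : exists r a0 : R, [/\ 0 < r, 0 < a0 &
  forall x a, C x -> `|x - z| < r -> 0 < a <= a0 ->
    exists y : E, euclid_proj C (x - a *: grad ip f x) y /\
      f y <= f x + cP p * ip (grad ip f x) (y - x)].
Proof.
have [_ _ [_ /andP[_ c1]] _] := p_ok.
have [r [a0 [r0 a00 H]]] := pgd_armijo_near z c1.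
exists r, a0; split => // x a Cx xz aa.
have C0 : C !=set0 by exists x.
have [y yP] := euclid_proj_nonempty (x - a *: grad ip f x) C0 C_closed.
by exists y; split => //; exact: H aa yP.
Qed.

Lemma pgd_stops x : C x ->
  exists j, first_index (fun i => exists y, pgd_trial ip C f p x i y) j.
Proof.
move=> Cx; have [_ aP _ [_ bP]] := p_ok.
have [r [a0 [r0 a00 H]]] := pgd_search_near x.
apply: (@backtracking_stops _ (alphaP p) (betaP p) a0 (fun a => exists y,
  euclid_proj C (x - a *: grad ip f x) y /\
  f y <= f x + cP p * ip (grad ip f x) (y - x))) => // a aa.
by apply: H; rewrite ?subrr ?normr0.
Qed.

Lemma pgd_nonincreasing x y : C x -> pgd_result ip C f p x y -> f y <= f x.
Proof.
move=> Cx [j _ [yP fy]]; have [_ aP [_ /andP[c0 _]] [_ /andP[b0 _]]] := p_ok.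
apply: (le_trans fy); rewrite gerDl pmulr_rle0//.
have := euclid_proj_self Cx yP; have := sqr_ge0 `|y - x|.
have a0 : 0 < 2 * (alphaP p * betaP p ^+ j) by rewrite !mulr_gt0 ?exprn_gt0.
by rewrite -(pmulr_rle0 _ a0); lra.
Qed.

(** A tangent direction [v] with [<grad f z, v> < 0] is approximated by points
    [W = z + tau j *: w j] of [C].  For [j] large the value at [x = z] of
    [`|W - x| ^+ 2 / (2 am) + <grad f x, W - x>] is negative, and by continuity
    it stays below half of that value for [x] near [z].  With this single
    [W] as a competitor in the projection, every accepted step, being at least
    [am], has a predicted decrease bounded away from 0. *)
Lemma pgd_uniform_decrease z : C z -> ~ terminal ip C f z ->
  exists r d : R, [/\ 0 < r, 0 < d &
  forall x y, C x -> `|x - z| < r -> pgd_result ip C f p x y -> f y <= f x - d].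
Proof.
move=> Cz; have [_ aP [_ /andP[c0 _]] [_ bP]] := p_ok.
have [r [a0 [r0 a00 H]]] := pgd_search_near z.
have [b0 _] := andP bP.
pose am := Num.min (alphaP p) (betaP p * a0).
have am0 : 0 < am by rewrite lt_min aP mulr_gt0.
move=> /existsNP [v /not_implyP [[tau [w [tau0 tau_cvg w_cvg Cw]]]]].
rewrite ipNl => /negP; rewrite -ltNge oppr_gt0 => gv.
have : (fun j => tau j * `|w j| ^+ 2 / (2 * am) + ip (grad ip f z) (w j)) @ \oo
    --> 0 * `|v| ^+ 2 / (2 * am) + ip (grad ip f z) v.
  apply: cvgD; last by apply: (ip_cvg ip_norm) => //; exact: cvg_cst.
  apply: cvgM; last exact: cvg_cst.
  by apply: cvgM => //; apply: cvgM; exact: cvg_norm.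
rewrite !mul0r add0r => /(cvgr_lt _) /(_ _ gv) [j _ /(_ j (leqnn j))] /= jlt0.
pose W := z + tau j *: w j.
pose Phi x := `|W - x| ^+ 2 / (2 * am) + ip (grad ip f x) (W - x).
have Phi_cvg : Phi x @[x --> z] --> Phi z.
  have WC : (W - x) @[x --> z] --> W - z.
    by apply: cvgB; [exact: cvg_cst|exact: cvg_id].
  apply: cvgD; last by apply: (ip_cvg ip_norm) => //; exact: grad_continuous.
  by apply: cvgM; [apply: cvgM; exact: cvg_norm|exact: cvg_cst].
have Phi0 : Phi z < 0.
  rewrite /Phi /W addrAC subrr add0r normrZ ipZr ger0_norm ?ltW//.
  rewrite [X in X < _](_ : _ = tau j *
    (tau j * `|w j| ^+ 2 / (2 * am) + ip (grad ip f z) (w j))); last by ring.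
  by rewrite pmulr_rlt0.
have : \forall x \near z, Phi x < Phi z / 2.
  by apply: (cvgr_lt _ Phi_cvg); move: Phi0; lra.
move=> /nbhs_normP [r1 /= r10 r1P].
exists (Num.min r r1), (- (cP p * (Phi z / 2))); split.
- by rewrite lt_min r0 r10.
- by rewrite oppr_gt0 pmulr_rlt0//; move: Phi0; lra.
move=> x y Cx; rewrite lt_min => /andP[xr xr1] [j' j'first [yP fy]].
rewrite opprK; apply: (le_trans fy); rewrite lerD2l ler_pM2l//.
apply: ltW; apply: le_lt_trans (r1P x _); last by rewrite /= distrC.
set a := alphaP p * betaP p ^+ j' in yP.
have ama : am <= a.
  apply: (@backtracking_step_ge _ (alphaP p) (betaP p) a0 (fun a => exists y,
    euclid_proj C (x - a *: grad ip f x) y /\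
    f y <= f x + cP p * ip (grad ip f x) (y - x))) j'first => // b bb.
  exact: H.
have a_gt0 : 0 < a := lt_le_trans am0 ama.
have := euclid_proj_ineq (Cw j) yP; rewrite -/W => ineq.
have {}ineq : 2 * a * ip (grad ip f x) (y - x) <=
    `|W - x| ^+ 2 + 2 * a * ip (grad ip f x) (W - x).
  by apply: le_trans ineq; rewrite lerDr sqr_ge0.
have a2 : 0 < 2 * a by rewrite mulr_gt0.
rewrite -(ler_pM2l a2); apply: (le_trans ineq); rewrite /Phi mulrDr lerD2r.
rewrite mulrCA ler_peMr ?sqr_ge0//.
by rewrite ler_pdivlMr ?mulr_gt0// mul1r ler_pM2l.
Qed.

End ProjectedGradient.

(** * Tangent cones of embedded manifolds *)

Lemma near_eq_continuous_at (T U : topologicalType) (h k : T -> U) (t : T) :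
  (\forall x \near t, h x = k x) -> {for t, continuous h} ->
  {for t, continuous k}.
Proof.
move=> hk hc; rewrite /prop_for /continuous_at -(nbhs_singleton hk).
by apply: cvg_trans hc; apply: near_eq_cvg; apply: filterS hk => x ->.
Qed.

Lemma Ck_pred (R : realType) (V W : normedModType R) k (U : set V)
    (h : V -> W) :
  Ck k.+1 U h -> Ck k U h.
Proof.
elim: k h => [|k IH] h [hd hk].
  by move=> x Ux; exact/differentiable_continuous/hd.
by split => // v; exact: IH.
Qed.

Lemma Ck_C1 (R : realType) (V W : normedModType R) k (U : set V)
    (h : V -> W) :
  Ck k.+1 U h -> Ck 1 U h.
Proof. by elim: k => // k IH /Ck_pred. Qed.

(** Difference quotients along moving directions converge to the differential.
    It is the link between tangent cones, defined by sequences, and tangent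
    spaces, defined by curves. *)
Lemma diff_quotient_cvg (R : realType) (V W : normedModType R) (h : V -> W)
    (x v : V) (tau : nat -> R) (w : nat -> V) : differentiable h x ->
    (forall j, 0 < tau j) -> tau @ \oo --> 0 -> w @ \oo --> v ->
  (fun j => (tau j)^-1 *: (h (x + tau j *: w j) - h x)) @ \oo --> 'd h x v.
Proof.
move=> dh tau0 tau_cvg w_cvg.
have tw_cvg : (fun j => tau j *: w j) @ \oo --> (0 : V).
  by rewrite -(scale0r v); exact: cvgZ.
have dw_cvg : (fun j => 'd h x (w j)) @ \oo --> 'd h x v.
  by apply: continuous_cvg => //; exact: diff_continuous.
rewrite -(addr0 ('d h x v)).
rewrite (_ : (fun j => _) = fun j => 'd h x (w j) +
    ((tau j)^-1 *: (h (x + tau j *: w j) - h x) - 'd h x (w j))); last first.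
  by apply/funext => j; rewrite subrKC.
apply: cvgD => //; apply/cvgr0Pnorm_le => e e0.
pose M := `|v| + 1.
have M0 : 0 < M by rewrite ltr_pwDr.
have wM : \forall j \near \oo, `|w j| <= M.
  by apply: (cvgr_norm_le _ w_cvg); rewrite ltrDl.
have := diff_locally dh => /eqaddoP /(_ (e / M)).
rewrite divr_gt0// => /(_ isT) small.
have {small} := tw_cvg _ small; rewrite /= => small.
near=> j.
have : `|(h \o shift x - (cst (h x) + 'd h x)) (tau j *: w j)| <=
    e / M * `|tau j *: w j|.
  by near: j; exact: small.
rewrite !fctE /= (addrC _ x) opprD addrA linearZ normrZ gtr0_norm// => H.
rewrite -(ler_pM2l (tau0 j)) -{1}(gtr0_norm (tau0 j)) -normrZ scalerBr.
rewrite scalerA divff ?gt_eqF// scale1r (le_trans H)//.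
rewrite mulrCA ler_pM2l// mulrAC ler_pdivrMr// ler_pM2l//.
by near: j.
Unshelve. all: by end_near. Qed.

Section Tangent.
Variables (R : realType) (E : normedVectType R).

(** Sample the curve along a sequence of positive times tending to 0.  The times
    are scaled by the radius [d] within which the curve stays in [U], because
    membership in [C] is required for all indices. *)
Lemma tangent_space_sub_cone (C M U : set E) x : open U -> U x ->
  C `&` U = M `&` U -> tangent_space M x `<=` tangent_cone C x.
Proof.
move=> Uo Ux CM v [I [c [[Io I0] cC1 cM c0 <-]]].
have [cd _] := cC1.
have dc := cd 0 I0.
have : \forall t \near (0 : R^o), I t /\ U (c t).
  apply: filterI; first exact: open_nbhs_nbhs.
  apply: (differentiable_continuous dc).
  by rewrite c0; exact: open_nbhs_nbhs.
move=> /nbhs_normP [d /= d0 dP].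
pose tau j : R := d / 2 * harmonic j.
have h0 j : 0 < @harmonic R j by rewrite /harmonic/= invr_gt0.
have tau0 j : 0 < tau j by rewrite /tau mulr_gt0// divr_gt0.
have taud j : tau j < d.
  rewrite /tau (@le_lt_trans _ _ (d / 2))//; last by move: d0; lra.
  apply: ler_piMr; first by rewrite divr_ge0// ltW.
  by rewrite /harmonic /= invf_le1 ?ltr0n// ler1n.
exists tau, (fun j => (tau j)^-1 *: (c (tau j) - c 0)); split => //.
- rewrite -(mulr0 (d / 2)); apply: cvgM; first exact: cvg_cst.
  exact: cvg_harmonic.
- rewrite deriveE//.
  have tc : tau @ \oo --> (0 : R).
    rewrite -(mulr0 (d / 2)); apply: cvgM; first exact: cvg_cst.
    exact: cvg_harmonic.
  have := @diff_quotient_cvg R R^o E c 0 1 tau (fun=> 1) dc tau0 tc (cvg_cst _).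
  suff -> : (fun j => (tau j)^-1 *: (c (0 + tau j *: (1 : R^o)) - c 0)) =
      (fun j => (tau j)^-1 *: (c (tau j) - c 0)) by move=> H; exact: H.
  by apply/funext => j; rewrite add0r [_ *: 1]mulr1.
move=> j; rewrite scalerA divff ?gt_eqF// scale1r c0 subrKC.
have [Ij Uj] : I (tau j) /\ U (c (tau j)).
  by apply: dP; rewrite /= sub0r normrN gtr0_norm.
have : (C `&` U) (c (tau j)) by rewrite CM; split => //; exact: cM.
by case.
Qed.

(** In a chart [phi] the quotients of the given sequence lie in the closed
    subspace [L], hence so does [u = 'd phi x v].  The line [phi x + t u] then
    stays in [L], and its image under the inverse chart is a curve in [M] with
    velocity [v]. *)
Lemma tangent_cone_sub_space k (C M U : set E) x : embedded_manifold k.+1 M ->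
  M x -> open U -> U x -> C `&` U = M `&` U ->
  tangent_cone C x `<=` tangent_space M x.
Proof.
move=> [L emb] Mx Uo Ux CM v [tau [w [tau0 tau_cvg w_cvg Cw]]].
have [U' [V [phi [psi [[U'o U'x] Vo phiV psiU [phiC psiC img]]]]]] := emb x Mx.
have [dphi _] := Ck_C1 phiC.
have [dpsi cpsi] := Ck_C1 psiC.
pose a := phi x; pose u := 'd phi x v.
have [Va psia] := phiV _ U'x.
have LU y : M y -> U' y -> phi y \in L.
  move=> My U'y; have : (phi @` (M `&` U')) (phi y) by exists y.
  by rewrite img => -[].
have uL : u \in L.
  have xw : (fun j => x + tau j *: w j) @ \oo --> x.
    rewrite -{2}(addr0 x) -(scale0r v); apply: cvgD; first exact: cvg_cst.
    exact: cvgZ.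
  have : \forall j \near \oo, U (x + tau j *: w j) /\ U' (x + tau j *: w j).
    by apply: filterI; apply: xw; exact: open_nbhs_nbhs.
  move=> near_UU'.
  have quotL : \forall j \near \oo, [set z | z \in L]
      ((tau j)^-1 *: (phi (x + tau j *: w j) - phi x)).
    apply: filterS near_UU' => j [Uj U'j] /=.
    have [Mj _] : (M `&` U) (x + tau j *: w j) by rewrite -CM.
    by rewrite memvZ// memvB// LU.
  have quot_cvg := diff_quotient_cvg (dphi _ U'x) tau0 tau_cvg w_cvg.
  exact: (@closed_cvg _ _ _ _ _ _ (@vspace_closed _ _ L) quotL _ quot_cvg).
pose l (t : R^o) := a + t *: u.
have lc : continuous l.
  move=> t; apply: cvgD; first exact: cvg_cst.
  exact: scalel_continuous.
exists (l @^-1` V), (psi \o l); split.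
- split; last by rewrite /= /l scale0r addr0.
  by apply: open_comp => // t _; exact: lc.
- have dl t : V (l t) ->
      is_diff t (psi \o l) (fun s : R^o => 'd psi (l t) (s *: u)).
    by move=> Vt; exact: (@diff_line _ _ _ psi a u t (dpsi _ Vt)).
  split => [t /dl[]//|s t Vt].
  apply: (@near_eq_continuous_at _ _ (fun t' => 'd psi (l t') (s *: u))).
    have : \forall t' \near t, V (l t') by apply: lc; exact: open_nbhs_nbhs.
    by apply: filterS => t' /dl [_ ->].
  apply: (@continuous_comp _ _ _ l (fun z => 'd psi z (s *: u))).
    exact: lc.
  exact: cpsi.
- move=> t Vt /=.
  have : (V `&` [set z | z \in L]) (l t).
    split => //=; rewrite memvD ?memvZ//; exact: LU.
  by rewrite -img => -[m [Mm U'm] <-]; have [_ ->] := phiV m U'm.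
- by rewrite /= /l scale0r addr0.
- have Vl0 : V (a + (0 : R) *: u) by rewrite scale0r addr0.
  have [dl dlE] := @diff_line _ _ _ psi a u 0 (dpsi _ Vl0).
  rewrite deriveE//.
  have := congr1 (fun k : R^o -> E => k 1) dlE.
  rewrite scale1r scale0r addr0 => ->.
  have -> : 'd psi a ('d phi x v) = 'd (psi \o phi) x v.
    have dcomp := diff_comp (dphi _ U'x) (dpsi _ Va).
    exact: (esym (congr1 (fun k : E -> E => k v) dcomp)).
  rewrite -deriveE; last first.
    by apply: differentiable_comp; [exact: dphi|exact: dpsi].
  rewrite (@near_eq_derive _ _ _ _ id) ?derive_id//.
  have : nbhs x U' by exact: open_nbhs_nbhs.
  by apply: filterS => y /phiV[].
Qed.
End Tangent.

(** * Linear projectors and linear minimization over a norm ball *)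

(** A set whose nearest-point map is single valued and linear is the subspace
    fixed by that map, and the map is its orthogonal projector. *)
Section LinearProjector.
Variables (R : realType) (E : normedVectType R) (ip : {dot E for idfun}).
Hypothesis ip_norm : forall x : E, ip x x = `|x| ^+ 2.
Variables (T : set E) (P : {linear E -> E}).
Hypothesis projP : forall u, euclid_proj T u = [set P u].

Lemma proj_mem u : T (P u).
Proof. by have [] : euclid_proj T u (P u) by rewrite projP. Qed.

Lemma proj_fixed u : T u -> P u = u.
Proof.
move=> Tu; have : euclid_proj T u u.
  by split => // y _; rewrite subrr normr0.
by rewrite projP.
Qed.

(** [P u + t w] stays in [T] for all [t]; minimality of the distance at [t = 0]
    is tested at the minimizer [t = k / `|w| ^+ 2] of the quadratic. *)
Lemma proj_orthogonal u w : T w -> ip (u - P u) w = 0.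
Proof.
move=> Tw.
have Pline t : T (P u + t *: w).
  have -> : P u + t *: w = P (P u + t *: w).
    by rewrite linearD linearZ/= (proj_fixed (proj_mem u)) (proj_fixed Tw).
  exact: proj_mem.
have [w0|w0] := eqVneq w 0; first by rewrite w0 ip0r.
have w2 : 0 < `|w| ^+ 2 by rewrite exprn_gt0// normr_gt0.
pose k := ip (u - P u) w.
have [_ /(_ _ (Pline (k / `|w| ^+ 2)))] : euclid_proj T u (P u).
  by rewrite projP.
rewrite -(@ler_pXn2r _ 2) ?nnegrE// addrAC (sqr_normD ip_norm (P u - u)).
rewrite -addrA lerDl ipZr normrZ exprMn real_normK ?num_real//.
rewrite -(opprB u) ipNl -/k => H.
have : 0 <= - (k ^+ 2 / `|w| ^+ 2).
  suff <- : 2 * (k / `|w| ^+ 2 * - k) + (k / `|w| ^+ 2) ^+ 2 * `|w| ^+ 2 =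
    - (k ^+ 2 / `|w| ^+ 2) by [].
  by field; rewrite normr_eq0.
rewrite oppr_ge0 pmulr_lle0 ?invr_gt0// => k2.
by apply/eqP; rewrite -/k -sqrf_eq0 eq_le k2 sqr_ge0.
Qed.

Lemma proj_selfadjoint u s : ip (P u) s = ip u (P s).
Proof.
transitivity (ip (P u) (P s)).
  rewrite -[in LHS](subrK (P s) s) ipDr (ipC ip _ (s - _)).
  by rewrite (proj_orthogonal _ (proj_mem u)) add0r.
rewrite -[in RHS](subrK (P u) u) ipDl.
by rewrite (proj_orthogonal _ (proj_mem s)) add0r.
Qed.

End LinearProjector.

Section DualNorm.
Variables (R : realType) (E : normedVectType R) (ip : {dot E for idfun}).
Hypothesis ip_norm : forall x : E, ip x x = `|x| ^+ 2.
Variables (N : E -> R).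
Hypothesis N_norm : is_norm N.

Lemma norm_continuous_findim : continuous (N : E -> R^o).
Proof.
have [K K0 NK] := norm_equiv N_norm.
apply: (@bounded_slope_continuous _ _ _ _ K K0) => x y.
exact: le_trans (is_norm_dist N_norm x y) (NK (x - y)).2.
Qed.

Lemma lmo_nonempty g : lmo ip N g !=set0.
Proof.
have [K K0 NK] := norm_equiv N_norm.
apply: argmin_nonempty_compact.
- by exists 0; rewrite /= (is_norm0 N_norm) ler01.
- apply: bounded_closed_compact_findim.
    exists K; split => [|M KM s /= Ns]; first exact: num_real.
    rewrite (le_trans (NK s).1)// (le_trans _ (ltW KM))//.
    by rewrite ler_piMr// ltW.
  rewrite [X in closed X](_ : _ = N @^-1` [set t | t <= 1])//.
  apply: preimage_closed; last exact: closed_le.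
  by move=> ? _; exact: norm_continuous_findim.
- exact: (ip_continuous ip_norm).
Qed.

(** The unit ball is symmetric, so the minimizer [s] turns into the maximizer
    [- s] and the supremum is attained. *)
Lemma dual_norm_lmo g s : lmo ip N g s -> dual_norm ip N g = - ip g s.
Proof.
move=> [Ns smin].
have ub : ubound [set ip g t | t in [set t | N t <= 1]] (- ip g s).
  move=> _ [t /= Nt <-]; rewrite lerNr -ipNr; apply: smin.
  by rewrite /= (is_normN N_norm).
apply/eqP; rewrite eq_le; apply/andP; split.
  apply: ge_sup => //; exists (ip g 0), 0 => //.
  by rewrite /= (is_norm0 N_norm) ler01.
apply: ub_le_sup; first by exists (- ip g s).
by exists (- s); rewrite /= ?(is_normN N_norm)// ipNr.
Qed.

Lemma ip_le_dual_norm g s t : lmo ip N g s -> N t <= 1 ->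
  ip g t <= dual_norm ip N g.
Proof.
move=> gs Nt; rewrite (dual_norm_lmo gs) lerNr -ipNr; case: gs => _; apply.
by rewrite /= (is_normN N_norm).
Qed.

End DualNorm.

(** * Steps along return maps *)

(** [s0] is the slope at the current point, [st] the one given by the mean value
    theorem, and [sz] the slope at the reference point to which both are close:
    they differ by at most [(1 - c) b / 2], which the slack of the Armijo
    condition absorbs. *)
Lemma armijo_of_slope (R : realType) (c b a d s0 st sz f0 f1 : R) :
    c < 1 -> 0 < a -> b / 2 <= d ->
    `|s0 - sz| <= (1 - c) * b / 4 -> `|st - sz| <= (1 - c) * b / 4 ->
    s0 = - d -> f1 - f0 = a * st ->
  f1 <= f0 - c * a * d.
Proof.
move=> c1 a0 bd; rewrite !ler_distl => /andP[s0z _] /andP[_ stz] s0d fE.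
have cd : (1 - c) * (b / 2) <= (1 - c) * d by rewrite ler_wpM2l// subr_ge0 ltW.
have : a * st <= a * (- (c * d)) by rewrite ler_pM2l//; lra.
rewrite -fE; lra.
Qed.

Lemma half_le_sub (R : realType) (c b s : R) : 0 < c -> 0 < b ->
  `|s - b| <= (1 - c) * b / 4 -> b / 2 <= s.
Proof.
by move=> c0 b0; rewrite ler_distl => /andP[H _]; have := mulr_gt0 c0 b0; lra.
Qed.

Section SmoothBranch.
Variables (R : realType) (E : normedVectType R) (ip : {dot E for idfun}).
Hypothesis ip_norm : forall x : E, ip x x = `|x| ^+ 2.
Variables (C : set E) (f : E -> R).
Hypothesis f_C1 : Ck 1 setT (f : E -> R^o).
Hypothesis grad_loc_lip : forall x : E,
  exists2 U : set E, nbhs x U & [lipschitz (grad ip f y) | y in U].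
Variables (Omega : set E) (Dom : E -> set E) (Ret : E -> E -> E).
Hypothesis safe : safe_region C Omega Dom Ret.

Lemma safe_sub x : Omega x -> C x.
Proof. by have [_ [F _ ->] _] := safe; case. Qed.

(** A return map lives on a relatively open subset of [M * E], where derivatives
    in [x] make no sense; [F] is a C^1 extension to an open subset of [E * E].
    Its partial differential in the second variable is a projector onto the
    tangent cone, by the identification of tangent cone and tangent space, and
    it now varies continuously with [x]. *)
Lemma return_map_extension z : Omega z ->
  exists (W : set (E * E)) (F : E * E -> E), [/\ open W, W (z, 0), Ck 1 W F &
  forall x, Omega x ->
    (forall u, W (x, u) -> Dom x u /\ Ret x u = F (x, u)) /\
    (W (x, 0) -> F (x, 0) = x /\
      exists2 P : {linear E -> E}, forall u, P u = 'd F (x, 0) (0, u) &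
        forall u, euclid_proj (tangent_cone C x) u = [set P u])].
Proof.
move=> Oz; have [_ _ /(_ z Oz) [U [M [Uo Uz Memb CM]]]] := safe.
move=> [D [r [[[Q opQ DE] D0 _ ext amb] Retr]]].
have DM x : Omega x -> U x -> M x.
  move=> /safe_sub Cx Ux; have : (C `&` U) x by [].
  by rewrite CM => -[].
have [Q1 [F [Q1o Q1z FC FE]]] := ext (z, 0) (D0 z (conj Oz Uz)).
have Qz : Q (z, 0) by have := D0 z (conj Oz Uz); rewrite DE => -[].
pose W := Q `&` Q1 `&` [set q | U q.1].
have Wo : open W.
  apply: openI; first exact: openI.
  by apply: (@open_comp _ _ (fst : E * E -> E)) => // q _; exact: cvg_fst.
have [dF cF] := Ck_C1 FC.
have WF x u : Omega x -> W (x, u) -> D (x, u) /\ r (x, u) = F (x, u).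
  move=> Ox [[Qxu Q1xu] /= Ux].
  have Dxu : D (x, u) by rewrite DE; split => //; split => //=; exact: DM.
  by split => //; rewrite FE.
exists W, F; split => //.
  split => [q [[_ Q1q] _]|v q [[_ Q1q] _]]; first exact: dF.
  exact: cF.
move=> x Ox; split.
  move=> u Oxu; have [Dxu <-] := WF x u Ox Oxu; apply: Retr => //.
  by split => //; case: Oxu.
move=> Ox0; have Ux : U x by case: Ox0.
have [_ rC _ r0 rP] := amb x (conj Ox Ux).
have [Dx0 rF0] := WF x 0 Ox Ox0.
split; first by rewrite -rF0.
have -> : tangent_cone C x = tangent_space M x.
  apply/seteqP; split; last exact: tangent_space_sub_cone CM.
  exact: (tangent_cone_sub_space Memb (DM _ Ox Ux) Uo Ux CM).
exists ('d (fun u => r (x, u)) 0) => // u.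
have [dr _] := Ck_C1 rC.
rewrite -deriveE; last exact: dr.
have pair_diff : is_diff (0 : E) (fun u : E => (x, u)) (fun u => (0, u)).
  exact: is_diff_pair.
have dpair : differentiable (fun u : E => (x, u)) 0 by exact: ex_diff.
have dFx : differentiable F (x, 0) by apply: dF; case: Ox0 => -[].
(* r (x, _) and F (x, _) agree only on a neighborhood of 0 *)
rewrite (@near_eq_derive _ _ _ _ (F \o (fun u => (x, u)))); last first.
  have Onb : nbhs (x, 0 : E) W by exact: open_nbhs_nbhs.
  have Wnear : \forall w \near (0 : E), W (x, w).
    exact: (differentiable_continuous dpair Onb).
  by apply: filterS Wnear => w Oxw /=; rewrite (WF x w Ox Oxw).2.
rewrite deriveE; last exact: (differentiable_comp dpair dFx).
by rewrite (diff_comp dpair dFx) /= diff_val.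
Qed.

Lemma safe_projector x : Omega x -> exists P : {linear E -> E},
  forall u, euclid_proj (tangent_cone C x) u = [set P u].
Proof.
move=> Ox; have [W [F [_ W0 _ /(_ x Ox) [_ /(_ W0) [_ [P _ HP]]]]]] :=
  return_map_extension Ox.
by exists P.
Qed.

Variables (N : E -> R) (p : mcsd_params R).
Hypothesis N_norm : is_norm N.
Hypothesis p_ok : admissible_params p.

Lemma smooth_choice_exists x : Omega x ->
  exists g s, smooth_choice ip C f N x g s.
Proof.
move=> /safe_projector [P HP].
have [s sP] := lmo_nonempty ip_norm N_norm (P (grad ip f x)).
by exists (P (grad ip f x)), s.
Qed.

(** Put [h = f \o F] and [D q s = 'd h q (0, s)].  Since the projector [P] at
    [x] is self-adjoint, [<g, s> = <grad f x, P s> = D (x, 0) s] for the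
    projected gradient [g].  At [z] there is [v1] in the unit ball with
    [b = D (z, 0) v1 > 0]; as [D q] is uniformly close to [D (z, 0)] on the unit
    ball for [q] near [(z, 0)], the dual norm of [g] is at least [b / 2], and
    the slope along the step stays within [(1 - c) b / 2] of the slope
    [<g, s>] at its start, whence the Armijo condition. *)
Lemma smooth_search_near z : Omega z -> ~ terminal ip C f z ->
  exists r a0 e : R, [/\ 0 < r, 0 < a0, 0 < e &
  forall x g s, Omega x -> `|x - z| < r -> smooth_choice ip C f N x g s ->
    e <= dual_norm ip N g /\
    forall a, 0 < a <= a0 -> Dom x (a *: s) /\
      f (Ret x (a *: s)) <= f x - cM p * a * dual_norm ip N g].
Proof.
move=> Oz /existsNP [v /not_implyP [Tv]].
rewrite ipNl => /negP; rewrite -ltNge oppr_gt0 => gv.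
have [_ NZ N0] := N_norm.
have [_ _ [/andP[c0 c1] _] _] := p_ok.
have [W [F [Wo Oz0 [dF cF] HF]]] := return_map_extension Oz.
pose h : E * E -> R^o := fun q => f (F q).
have df x : differentiable (f : E -> R^o) x by case: f_C1 => + _; exact.
have dh q : W q -> differentiable h q.
  move=> Oq; apply: (@differentiable_comp _ _ _ _ F (f : E -> R^o)) => //.
  exact: dF.
have dhE q w : W q -> 'd h q w = ip (grad ip f (F q)) ('d F q w).
  move=> Oq; rewrite -(gradP ip_norm).
  by rewrite (@diff_comp _ _ _ _ F (f : E -> R^o))//; exact: dF.
pose D q (s : E) : R := 'd h q (0, s).
have gD x g s t : Omega x -> W (x, 0) -> smooth_choice ip C f N x g s ->
    ip g t = D (x, 0) t.
  move=> Ox Ox0 [gP _]; have [_ /(_ Ox0) [Fx [P PF HP]]] := HF x Ox.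
  have -> : g = P (grad ip f x).
    by have : [set P (grad ip f x)] g by rewrite -HP gP.
  by rewrite (proj_selfadjoint ip_norm HP) /D dhE// Fx PF.
have pairD (s t : E) : (0 : E, s + t) = (0, s) + (0, t).
  by apply: injective_projections => //=; rewrite addr0.
have pairZ a (s : E) : (0 : E, a *: s) = a *: (0, s).
  by apply: injective_projections => //=; rewrite scaler0.
have DD q s t : D q (s + t) = D q s + D q t by rewrite /D pairD linearD.
have DZ q a s : D q (a *: s) = a * D q s by rewrite /D pairZ linearZ.
have DN q s : D q (- s) = - D q s by rewrite -scaleN1r DZ mulN1r.
have vz : D (z, 0) v < 0.
  rewrite /D dhE//; have [_ /(_ Oz0) [-> [P PF HP]]] := HF z Oz.
  by rewrite -PF (proj_fixed HP Tv).
have Nv : 0 < N v.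
  rewrite lt_neqAle (is_norm_ge0 N_norm) andbT eq_sym; apply/eqP => /N0 v0.
  by move: vz; rewrite v0 -(scale0r 0) DZ mul0r ltxx.
pose v1 := (N v)^-1 *: - v.
have Nv1 : N v1 <= 1.
  by rewrite NZ (is_normN N_norm) gtr0_norm ?invr_gt0// mulVf ?gt_eqF.
pose b := D (z, 0) v1.
have b0 : 0 < b by rewrite /b DZ DN mulr_gt0 ?invr_gt0// oppr_gt0.
have [K K0 NK] := norm_equiv N_norm.
have NsK s : N s <= 1 -> `|s| <= K.
  by move=> Ns; rewrite (le_trans (NK s).1)// ler_piMr// ltW.
(* K bounds the Euclidean norm on the unit ball of N, so the slopes of unit
   directions differ by at most eta * K = (1 - cM p) * b / 4 *)
pose eta := (1 - cM p) * b / (4 * K).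
have eta0 : 0 < eta by rewrite divr_gt0 ?mulr_gt0 ?subr_gt0.
have etaK : eta * K = (1 - cM p) * b / 4 by rewrite /eta; field; lra.
have : \forall q \near (z, 0 : E),
    forall s, `|D q s - D (z, 0) s| <= eta * `|s|.
  apply: (@seminorm_cvg_uniform R E (E * E)%type (nbhs (z, 0 : E)) _
    (fun q s => `|D q s - D (z, 0) s|)) => //.
  - move=> q s t; rewrite !DD (le_trans _ (ler_normD _ _))// opprD.
    by rewrite addrACA.
  - by move=> q a s; rewrite !DZ -mulrBr normrM.
  move=> s.
  suff Dc : {for (z, 0 : E), continuous (fun q => D q s)}.
    by apply/norm_cvg0P/subr_cvg0; exact: Dc.
  have zW : nbhs (z, 0 : E) W by exact: open_nbhs_nbhs.
  apply: (@near_eq_continuous_at _ _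
    (fun q => ip (grad ip f (F q)) ('d F q (0, s)))).
    by apply: filterS zW => q Wq; rewrite /D dhE.
  apply: (ip_cvg ip_norm) => //; last exact: cF.
  apply: continuous_comp; last exact: (grad_continuous grad_loc_lip).
  by apply: differentiable_continuous; exact: dF.
move=> Dclose.
have : \forall q \near (z, 0 : E), W q /\
    forall s, `|D q s - D (z, 0) s| <= eta * `|s|.
  by apply: filterI => //; exact: open_nbhs_nbhs.
move=> /nbhs_normP [r /= r0 rP].
have near_rP x u : `|x - z| < r -> `|u| < r -> W (x, u) /\
    forall s, N s <= 1 -> `|D (x, u) s - D (z, 0) s| <= (1 - cM p) * b / 4.
  move=> xr ur; have [|Oxu H] := rP (x, u).
    by rewrite /= prod_normE /= gt_max distrC xr sub0r normrN ur.
  split => // s /NsK sK; rewrite -etaK; apply: le_trans (H s) _.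
  by rewrite ler_wpM2l// ltW.
exists r, (r / (2 * K)), (b / 2); split => //; rewrite ?divr_gt0 ?mulr_gt0//.
move=> x g s Ox xr ch.
have [Ox0 Hx0] := near_rP x 0 xr (eq_ind_r (fun t => t < r) r0 (normr0 _)).
have [_ sP] := ch; have [Ns _] := sP.
have dual_ge : b / 2 <= dual_norm ip N g.
  apply: le_trans (ip_le_dual_norm N_norm sP Nv1).
  rewrite (gD x g s v1 Ox Ox0 ch).
  exact: (half_le_sub c0 b0 (Hx0 v1 Nv1)).
split => // a /andP[a0 aa0].
have asr t : 0 <= t <= 1 -> `|t *: (a *: s)| < r.
  move=> /andP[t0 t1]; rewrite scalerA normrZ ger0_norm ?mulr_ge0 ?(ltW a0)//.
  have : t * a * `|s| <= a * K.
    by rewrite ler_pM ?mulr_ge0 ?(ltW a0)// ?NsK// ler_piMl// ltW.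
  move=> /le_lt_trans; apply; move: aa0; rewrite ler_pdivlMr ?mulr_gt0//.
  by move: r0; lra.
have [HD _] := HF x Ox.
have as1 : `|a *: s| < r.
  by rewrite -(scale1r (a *: s)); apply: asr; rewrite ler01 lexx.
have [Oxa _] := near_rP x (a *: s) xr as1.
have [Da RetE] := HD _ Oxa; split => //; rewrite RetE.
have seg t : (x, 0) + t *: (0, a *: s) = (x, t *: (a *: s)) :> E * E.
  by apply: injective_projections => /=; rewrite ?scaler0 ?addr0 ?add0r.
have [t t01|t t01] := @mean_value_segment _ _ h (x, 0) (0, a *: s).
  by rewrite seg; apply: dh; exact: (near_rP _ _ xr (asr t t01)).1.
rewrite seg -[(0, a *: s)]scale1r seg scale1r /h.
have [_ /(_ Ox0) [-> _]] := HF x Ox.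
rewrite scale1r -/(D (x, t *: (a *: s)) (a *: s)) DZ => fE.
have [_ Ht] := near_rP _ _ xr (asr t t01).
apply: (armijo_of_slope c1 a0 dual_ge (Hx0 s Ns) (Ht s Ns) _ fE).
by rewrite -(gD x g s s Ox Ox0 ch) (dual_norm_lmo N_norm sP) opprK.
Qed.

End SmoothBranch.

(** * Termination and accumulation points *)

Section Convergence.
Variables (R : realType) (E : normedVectType R) (ip : {dot E for idfun}).
Hypothesis ip_norm : forall x : E, ip x x = `|x| ^+ 2.
Variables (C : set E) (f : E -> R).
Hypothesis C_closed : closed C.
Hypothesis f_C1 : Ck 1 setT (f : E -> R^o).
Hypothesis grad_loc_lip : forall x : E,
  exists2 U : set E, nbhs x U & [lipschitz (grad ip f y) | y in U].
Variables (Omega : set E) (Dom : E -> set E) (Ret : E -> E -> E).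
Hypothesis safe : safe_region C Omega Dom Ret.
Variables (N : E -> R) (p : mcsd_params R).
Hypothesis N_norm : is_norm N.
Hypothesis p_ok : admissible_params p.

Let search_near :=
  smooth_search_near ip_norm f_C1 grad_loc_lip safe N_norm p_ok.

Lemma smooth_stops x g s : Omega x -> ~ terminal ip C f x ->
  smooth_choice ip C f N x g s ->
  exists j, first_index (smooth_trial ip f N Dom Ret p x g s) j.
Proof.
move=> Ox nt ch; have [aM _ _ [bM _]] := p_ok.
have [r [a0 [e [r0 a00 _ H]]]] := search_near Ox nt.
have [_ trial] := H x g s Ox (eq_ind_r (fun t => `|t| < r)
  (eq_ind_r (fun t => t < r) r0 (normr0 E)) (subrr x)) ch.
exact: (@backtracking_stops _ (alphaM p) (betaM p) a0
  (fun a => Dom x (a *: s) /\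
  f (Ret x (a *: s)) <= f x - cM p * a * dual_norm ip N g)).
Qed.

Lemma smooth_uniform_decrease z : Omega z -> ~ terminal ip C f z ->
  exists r d : R, [/\ 0 < r, 0 < d &
  forall x g s y, Omega x -> `|x - z| < r -> smooth_choice ip C f N x g s ->
    smooth_result ip f N Dom Ret p x g s y -> f y <= f x - d].
Proof.
move=> Oz nt; have [aM _ [/andP[c0 _] _] [bM _]] := p_ok.
have [r [a0 [e [r0 a00 e0 H]]]] := search_near Oz nt.
have [b0 _] := andP bM.
pose am := Num.min (alphaM p) (betaM p * a0).
have am0 : 0 < am by rewrite lt_min aM mulr_gt0.
exists r, (cM p * am * e); split => //; first by rewrite !mulr_gt0.
move=> x g s y Ox xr ch [j j_first ->].
have [ge_e trial] := H x g s Ox xr ch.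
have am_le : am <= alphaM p * betaM p ^+ j.
  exact: (@backtracking_step_ge _ (alphaM p) (betaM p) a0
    (fun a => Dom x (a *: s) /\
    f (Ret x (a *: s)) <= f x - cM p * a * dual_norm ip N g)) j_first.
have [[_ fy] _] := j_first; apply: (le_trans fy).
rewrite lerD2l lerN2 -[leLHS]mulrA -[leRHS]mulrA ler_pM2l//.
by rewrite ler_pM// ltW.
Qed.

Lemma smooth_nonincreasing x g s y : smooth_choice ip C f N x g s ->
  smooth_result ip f N Dom Ret p x g s y -> f y <= f x.
Proof.
move=> [_ sP] [j [[_ fy] _] ->]; apply: (le_trans fy).
have [aM _ [/andP[c0 _] _] [/andP[b0 _] _]] := p_ok.
rewrite gerBl mulr_ge0//; first by rewrite !mulr_ge0 ?exprn_ge0 ?ltW.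
rewrite -(ip0r ip g) (ip_le_dual_norm N_norm sP)//.
by rewrite (is_norm0 N_norm) ler01.
Qed.

Lemma line_search_terminates x : C x -> ~ terminal ip C f x ->
  line_search_succeeds ip C f N Omega Dom Ret p x.
Proof.
move=> Cx nt; split => Ox; split.
- exact: (smooth_choice_exists ip_norm f safe N_norm Ox).
- move=> g s ch; split; first exact: smooth_stops.
  move=> y [j [[Dx _] _] ->]; have [/(_ x Ox) [_ _ RC] _ _] := safe.
  exact: RC.
- exact: (pgd_stops ip_norm f_C1 grad_loc_lip p_ok C_closed).
- by move=> y [j _ [[]]].
Qed.

Local Notation step := (mcsd_step ip C f N Omega Dom Ret p).

Lemma step_exists x : C x -> ~ terminal ip C f x -> exists y, step x y.
Proof.
move=> Cx nt; have [smooth pgd] := line_search_terminates Cx nt.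
have [Ox|Ox] := pselect (Omega x).
  have [[g [s ch]] /(_ g s ch) [[j jP] _]] := smooth Ox.
  exists (Ret x ((alphaM p * betaM p ^+ j) *: s)); split => //; left.
  split => //.
  by exists g, s; split => //; exists j.
have [[j [[y yP] jmin]] _] := pgd Ox.
exists y; split => //; right; split => //; exists j => //.
by split => //; exists y.
Qed.

Lemma step_in x y : C x -> step x y -> C y.
Proof.
move=> Cx [nt H]; have [smooth pgd] := line_search_terminates Cx nt.
case: H => [[Ox [g [s [ch yP]]]]|[Ox yP]].
  by have [_ /(_ g s ch) [_]] := smooth Ox; apply.
by have [_] := pgd Ox; apply.
Qed.

Lemma step_nonincreasing x y : C x -> step x y -> f y <= f x.
Proof.
move=> Cx [_ [[_ [g [s [ch]]]]|[_]]].
  exact: smooth_nonincreasing.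
exact: (pgd_nonincreasing ip_norm p_ok).
Qed.

(** Near a point of [Omega] both branches may be active and the worse of the two
    bounds is taken.  Since [Omega] is relatively closed in [C], only the
    projected gradient branch is active near any other point of [C]. *)
Lemma step_uniform_decrease z : C z -> ~ terminal ip C f z ->
  exists r d : R, [/\ 0 < r, 0 < d &
    forall x y, C x -> `|x - z| < r -> step x y -> f y <= f x - d].
Proof.
move=> Cz nt.
have [r [d [r0 d0 H]]] := pgd_uniform_decrease ip_norm f_C1 grad_loc_lip p_ok
  C_closed Cz nt.
have [Oz|Oz] := pselect (Omega z).
  have [r' [d' [r'0 d'0 H']]] := smooth_uniform_decrease Oz nt.
  exists (Num.min r r'), (Num.min d d'); split; rewrite ?lt_min ?r0 ?d0//.
  move=> x y Cx; rewrite lt_min => /andP[xr xr'] [_].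
  case=> [[Ox [g [s [ch yP]]]]|[_ yP]].
    rewrite (le_trans (H' x g s y Ox xr' ch yP))// lerD2l lerN2.
    by rewrite ge_min lexx orbT.
  by rewrite (le_trans (H x y Cx xr yP))// lerD2l lerN2 ge_min lexx.
have [_ [F F_closed OmegaE] _] := safe.
have : nbhs z (~` F).
  apply: open_nbhs_nbhs; split; first exact: closed_openC.
  by move=> Fz; apply: Oz; rewrite OmegaE.
move=> /nbhs_normP [r' /= r'0 r'F].
exists (Num.min r r'), d; split; rewrite ?lt_min ?r0//.
move=> x y Cx; rewrite lt_min => /andP[xr xr'] [_].
case=> [[Ox _]|[_ yP]]; last exact: H yP.
exfalso; move: Ox; rewrite OmegaE => -[_]; apply: r'F.
by rewrite /= distrC.
Qed.

(** The values [f (xs t)] decrease and, by continuity at the accumulation point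
    [z], are all at least [f z] and eventually within [d] of it at iterates
    close to [z].  If [z] were not stationary, one more step from such an
    iterate would lead below [f z]. *)
Lemma accumulation_stationary (xs : nat -> E) z :
    (forall t, C (xs t)) -> (forall t, step (xs t) (xs t.+1)) ->
  cluster (xs @ \oo) z -> bouligand_stationary ip C f z.
Proof.
move=> Cxs steps clz.
have Cz : C z.
  apply: C_closed => B /(clz (xs @` [set: nat])) H.
  have [|y [[t _ <-] By]] := H; first by exists 0%N => // t _; exists t.
  by exists (xs t).
split => //; apply: contrapT => nt.
have [r [d [r0 d0 H]]] := step_uniform_decrease Cz nt.
have fdec : {homo (f \o xs) : n m / (n <= m)%N >-> m <= n}.
  apply: homo_leq => //= [a b c|t]; first exact: ge_trans.
  exact: step_nonincreasing.
have fc : {for z, continuous (f : E -> R^o)}.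
  by apply: differentiable_continuous; case: f_C1 => + _; exact.
have f_ge t : f z <= f (xs t).
  rewrite leNgt; apply/negP => lt_fz.
  have Bz : nbhs z [set y | f (xs t) < f y].
    by apply: (cvgr_gt _ fc).
  have [|y [[s ts <-] /= fs]] := clz (xs @` [set s | (t <= s)%N]) _ _ Bz.
    by exists t => // s ts; exists s.
  by have := fdec t s ts; rewrite /= leNgt fs.
have Bz : nbhs z [set y | `|y - z| < r /\ f y < f z + d].
  apply: filterI.
    by apply/nbhs_normP; exists r => // y /=; rewrite distrC.
  by apply: (cvgr_lt _ fc); rewrite ltrDl.
have [|y [[s _ <-] [sr fs]]] := clz (xs @` [set: nat]) _ _ Bz.
  by exists 0%N => // s _; exists s.
have := H _ _ (Cxs s) sr (steps s); have := f_ge s.+1; lra.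
Qed.

End Convergence.

Theorem theorem4p9 (R : realType) (E : normedVectType R)
    (ip : {dot E for idfun}) (ip_norm : forall x : E, ip x x = `|x| ^+ 2)
    (C : set E) (C_nonempty : C !=set0) (C_closed : closed C)
    (f : E -> R) (f_C1 : Ck 1 setT (f : E -> R^o))
    (grad_loc_lip : forall x : E,
       exists2 U : set E, nbhs x U & [lipschitz (grad ip f y) | y in U])
    (Omega : set E) (Dom : E -> set E) (Ret : E -> E -> E)
    (safe : safe_region C Omega Dom Ret)
    (N : E -> R) (N_norm : is_norm N)
    (p : mcsd_params R) (p_ok : admissible_params p)
    (x0 : E) (x0_in : C x0)
    (X : nat -> option E) (X_run : mcsd_run ip C f N Omega Dom Ret p x0 X) :
  (forall t x, X t = Some x -> ~ terminal ip C f x ->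
     line_search_succeeds ip C f N Omega Dom Ret p x /\
     (exists2 y, X t.+1 = Some y & C y)) /\
  ((exists T x, [/\ X T = Some x, X T.+1 = None &
                    bouligand_stationary ip C f x]) \/
   (exists xs : nat -> E, (forall t, X t = Some (xs t)) /\
      forall z, cluster (xs @ \oo) z -> bouligand_stationary ip C f z)).
Proof.
have [X0 Xstep] := X_run.
have in_C t x : X t = Some x -> C x.
  elim: t x => [|t IH] x; first by rewrite X0 => -[<-].
  have := Xstep t; case Xt : (X t) => [x'|]; last by move=> ->.
  case=> [[y xy ->] [<-]|[_ ->]//].
  exact: (step_in ip_norm C_closed f_C1 grad_loc_lip safe N_norm p_ok
    (IH _ Xt) xy).
have next t x : X t = Some x -> ~ terminal ip C f x ->
    exists2 y, X t.+1 = Some y & C y.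
  move=> Xt nt; have := Xstep t; rewrite Xt => -[[y _ Xy]|[no_step _]].
    by exists y => //; exact: in_C Xy.
  have [y xy] := step_exists ip_norm C_closed f_C1 grad_loc_lip safe N_norm p_ok
    (in_C _ _ Xt) nt.
  by case: (no_step y).
split=> [t x Xt nt|].
  split; last exact: (next _ _ Xt nt).
  exact: (line_search_terminates ip_norm C_closed f_C1 grad_loc_lip safe N_norm
    p_ok (in_C _ _ Xt) nt).
have [[t Xt]|all_some] := pselect (exists t, X t = None).
  left; elim: t Xt => [|t IH]; first by rewrite X0.
  case Xt : (X t) => [x|] XtS; last exact: IH.
  exists t, x; split => //; split; first exact: in_C Xt.
  by apply: contrapT => /(next _ _ Xt) [y]; rewrite XtS.
right.
have some t : exists x, X t = Some x.
  case Xt : (X t) => [x|]; first by exists x.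
  by case: all_some; exists t.
have [xs xsE] := choice some.
exists xs; split => // z.
apply: (accumulation_stationary ip_norm C_closed f_C1 grad_loc_lip safe
  N_norm p_ok).
  by move=> t; exact: in_C (xsE t).
move=> t; have := Xstep t; rewrite !xsE => -[[y xy [->]]|[_]] //.
Qed.
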